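(* Let $R$ be a finite commutative ring with identity, let $n\ge 1$, and let $C\subseteq R^n$ be a linear code over $R$ with $C^\perp\neq\{0\}$. Then $\mathrm{Str}(C)=w_H(C^\perp)-1$.
   Context: A linear code $C$ of length $n$ over a commutative ring $R$ with identity is an $R$-submodule of the free module $R^n$. Its dual is $C^\perp=\{(x_1,\ldots,x_n)\in R^n : x_1c_1+\cdots+x_nc_n=0 \text{ for all } (c_1,\ldots,c_n)\in C\}$. The Hamming weight $w_H(x)$ of $x\in R^n$ is the number of non-zero coordinates of $x$. For a non-zero linear code $D$, $w_H(D)$ denotes the minimum Hamming weight among all non-zero codewords of $D$. An $N\times k$ array with entries from a finite alphabet $F$ is an orthogonal array of strength $t$ and index $\lambda$ (where $0\le t\le k$) if every $N\times t$ subarray (obtained by choosing $t$ distinct columns) contains each $t$-tuple over $F$ exactly $\lambda$ times as a row. A code $D\subseteq F^k$ (linear or not) is an orthogonal array of strength $t$ if the array whose rows are the codewords of $D$, each listed once, is an orthogonal array of strength $t$ for some index $\lambda$. $\mathrm{Str}(D)$ denotes the strength of $D$, i.e. the largest $t$ with $0\le t\le k$ such that $D$ is an orthogonal array of strength $t$. Here the alphabet is $F=R$. *)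

(* Defs.v *)
From mathcomp Require Import all_boot all_order all_algebra.
Set Implicit Arguments.
Unset Strict Implicit.
Unset Printing Implicit Defensive.
Import GRing.Theory.
Local Open Scope ring_scope.

Section OrthogonalArrays.
Variable F : finType.

(* A choice of t distinct columns is an injective function f. *)
Definition orthogonal_array (N k : nat) (A : 'M[F]_(N, k)) (t lambda : nat) :=
  (t <= k)%N &&
  [forall f : {ffun 'I_t -> 'I_k}, injectiveb f ==>
    [forall u : 'rV[F]_t, #|[set i | row i (colsub f A) == u]| == lambda]].

Definition code_array (k : nat) (D : {set 'rV[F]_k}) : 'M[F]_(#|D|, k) :=
  \matrix_(i < #|D|, j < k) (enum_val i : 'rV[F]_k) 0 j.

(* Bounding the index by #|D| loses nothing, see [has_strengthP]. *)
Definition has_strength (k : nat) (D : {set 'rV[F]_k}) (t : nat) :=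
  [exists lambda : 'I_#|D|.+1, orthogonal_array (code_array D) t lambda].

(* The maximum is over a nonempty set, see [has_strength0]. *)
Definition Str (k : nat) (D : {set 'rV[F]_k}) : nat :=
  (\max_(t < k.+1 | has_strength D t) t)%N.

Lemma orthogonal_arrayP (N k : nat) (A : 'M[F]_(N, k)) (t lambda : nat) :
  reflect ((t <= k)%N /\
           forall f : 'I_t -> 'I_k, injective f -> forall u : 'rV[F]_t,
             #|[set i | row i (colsub f A) == u]| = lambda)
          (orthogonal_array A t lambda).
Proof.
apply: (iffP andP) => -[letk oaA]; split=> //.
  move=> f injf u.
  have /forallP/(_ (finfun f))/implyP := oaA.
  have injf' : injectiveb (finfun f).
    by apply/injectiveP => x y; rewrite !ffunE => /injf.
  move=> /(_ injf')/forallP/(_ u)/eqP <-; apply: eq_card => i; rewrite !inE.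
  by congr (_ == u); apply/rowP => j; rewrite !mxE ffunE.
apply/forallP => f; apply/implyP => /injectiveP injf.
by apply/forallP => u; apply/eqP; apply: oaA.
Qed.

Lemma has_strengthP (k : nat) (D : {set 'rV[F]_k}) (t : nat) :
  reflect (exists lambda, orthogonal_array (code_array D) t lambda)
          (has_strength D t).
Proof.
apply: (iffP existsP) => [[l oaD]|[l oaD]]; first by exists l.
have [lel | ltl] := leqP l #|D|.
  by exists (Ordinal (lel : (l < #|D|.+1)%N)).
exists ord0; have /orthogonal_arrayP[letk oaD'] := oaD.
apply/orthogonal_arrayP; split=> // f injf u.
have := max_card (mem [set i | row i (colsub f (code_array D)) == u]).
by rewrite (oaD' f injf u) card_ord leqNgt ltl.
Qed.

Lemma has_strength0 (k : nat) (D : {set 'rV[F]_k}) : has_strength D 0.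
Proof.
apply/has_strengthP; exists #|D|; apply/orthogonal_arrayP; split=> // f _ u.
rewrite -[RHS]card_ord; apply: eq_card => i; rewrite !inE.
by apply/eqP/rowP => -[].
Qed.

End OrthogonalArrays.

Section LinearCodes.
Variables (R : finComPzRingType) (n : nat).

Definition linear_code (C : {set 'rV[R]_n}) : Prop := GRing.submod_closed C.

Definition dual_code (C : {set 'rV[R]_n}) : {set 'rV[R]_n} :=
  [set x : 'rV[R]_n | [forall c in C, \sum_(i < n) x 0 i * c 0 i == 0]].

Definition wH (x : 'rV[R]_n) : nat := #|[set i | x 0 i != 0]|.

(* As wH x <= n for all x, the default value n of the iterated minimum only
   matters when D has no nonzero codeword. *)
Definition min_wH (D : {set 'rV[R]_n}) : nat :=
  \big[minn/n]_(x in D | x != 0) wH x.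

End LinearCodes.

(* Main.v *)
(** For a linear code C, the fibres of the projection of C onto a set of t columns
are translates of one another, so C has strength t iff every such projection is
onto R^t.  A codeword x of the dual with support inside the t columns prevents
this, since x pairs nontrivially with some unit vector.  Conversely, if the image
M of a projection is a proper submodule of R^t, then R^t / M has a simple quotient
R / m, and R / m embeds in R because R is finite; the resulting nonzero linear form
on R^t that kills M is a codeword of the dual supported on these t columns. *)

Require Import Defs.
From mathcomp Require Import all_boot all_order all_algebra.
Import GRing.Theory.
Local Open Scope ring_scope.

Lemma prime_ideal_annihilator (R : finComPzRingType) (m : {set R})
    (mZD : forall a, {in m &, forall r s, a * r + s \in m}) (m0 : 0 \in m)
    (m1 : 1 \notin m)
    (prime_m : forall r s, r * s \in m -> (r \in m) || (s \in m)) :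
  exists2 y : R, y != 0 & {in m, forall a, a * y = 0}.
Proof.
(* Among the [y] with annihilator inside [m], one generating a smallest ideal is
   killed by [m]: otherwise [a * y], or [s * y] for some [s] outside [m] killing
   [a * y], generates a smaller one. *)
pose P (y : R) := [forall r, (r * y == 0) ==> (r \in m)].
pose I (y : R) := [set c * y | c in [set: R]].
have P1 : P 1 by apply/forallP => r; apply/implyP; rewrite mulr1 => /eqP->.
case: (@arg_minnP _ 1 P (fun y => #|I y|) P1) => y /forallP Py miny.
have {}Py r : r * y = 0 -> r \in m by move=> ry0; apply: (implyP (Py r)); apply/eqP.
exists y.
  by apply: contraNneq m1 => y0; apply: Py; rewrite y0 mulr0.
move=> a am; apply/eqP; apply: contraNT m1 => ay0.
have y_mem s : P (s * y) -> exists c, y = c * (s * y).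
  move=> Psy.
  have sub : I (s * y) \subset I y.
    by apply/subsetP => _ /imsetP[c _ ->]; rewrite mulrA; apply: imset_f.
  have /eqP Isy : I (s * y) == I y by rewrite eqEcard sub miny.
  have : y \in I y by apply/imsetP; exists 1; rewrite ?mul1r ?inE.
  by rewrite -Isy => /imsetP[c _ yE]; exists c.
have [Pay|] := boolP (P (a * y)).
  have [c yE] := y_mem a Pay.
  have /Py cam : (1 - c * a) * y = 0 by rewrite mulrBl mul1r -mulrA -yE subrr.
  rewrite -[1](subrK (c * a)) addrC.
  exact: mZD.
rewrite negb_forall => /existsP[s]; rewrite negb_imply => /andP[/eqP say0 sm].
(* Since [s] is outside the prime [m], the annihilator of [s * y] still lies in [m]. Minimality then
   makes [y] a multiple of [s * y], which [a] kills. *)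
have [|c yE] := y_mem s.
  apply/forallP => r; apply/implyP => /eqP rsy0.
  have /prime_m : r * s \in m by apply: Py; rewrite -mulrA.
  by rewrite (negPf sm) orbF.
by case/eqP: ay0; rewrite yE mulrCA (mulrCA a) say0 mulr0.
Qed.

(** Duals reverse inclusion, so [M] may be enlarged while it stays proper; induction on the size of
    its complement reduces to a maximal [M]. *)
Lemma dual_code_neq0 (R : finComPzRingType) (t : nat) (M : {set 'rV[R]_t})
    (linM : linear_code M) (properM : M != setT) :
  exists2 x, x \in dual_code M & x != 0.
Proof.
have [k] := ubnP #|~: M|; elim: k => // k IHk in M linM properM *.
rewrite ltnS => leMk; have [M0 ML] := linM.
have MD : {in M &, forall u v, u + v \in M}.
  by move=> u v uM vM; rewrite -[u]scale1r ML.
have MZ a : {in M, forall u, a *: u \in M}.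
  by move=> u uM; rewrite -[_ *: _]addr0 ML.
have MB : {in M &, forall u v, u - v \in M}.
  by move=> u v uM vM; rewrite MD // -scaleN1r MZ.
pose adjoin (w : 'rV[R]_t) := [set v : 'rV[R]_t | [exists a : R, v - a *: w \in M]].
have sub_adjoin w : M \subset adjoin w.
  apply/subsetP => v vM; rewrite inE; apply/existsP; exists 0.
  by rewrite scale0r subr0.
have [/existsP[w /andP[wM adjw]]|] :=
    boolP [exists w, (w \notin M) && (adjoin w != setT)].
  have lin_adj : linear_code (adjoin w).
    split=> [|a u v]; first exact: (subsetP (sub_adjoin w)).
    rewrite !inE => /existsP[b ub] /existsP[c vc]; apply/existsP.
    exists (a * b + c); rewrite scalerDl opprD addrACA -scalerA -scalerBr.
    exact: ML.
  have [|x xadj x0] := IHk _ lin_adj adjw.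
    apply: leq_trans leMk; apply: proper_card; rewrite properEneq setCS sub_adjoin.
    rewrite andbT (inj_eq (@setC_inj _)); apply: contraNneq wM => <-.
    by rewrite inE; apply/existsP; exists 1; rewrite scale1r subrr.
  exists x => //; move: xadj; rewrite !inE => /forall_inP xadj.
  by apply/forall_inP => c cM; apply: xadj; apply: (subsetP (sub_adjoin w)).
rewrite negb_exists => /forallP maxM.
have {}maxM w v : w \notin M -> exists a, v - a *: w \in M.
  move=> wM; have := maxM w; rewrite wM negbK => /eqP adjT.
  by have := in_setT v; rewrite -adjT inE => /existsP.
pose e i : 'rV[R]_t := delta_mx 0 i.
have Msum (u : 'I_t -> 'rV[R]_t) (a : 'I_t -> R) :
    (forall j, u j \in M) -> \sum_j a j *: u j \in M.
  by move=> uM; apply: (big_ind (fun v => v \in M)) => // j _; apply: MZ.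
have /existsP[i eiM] : [exists i, e i \notin M].
  apply: contraR properM; rewrite negb_exists => /forallP eM; apply/eqP/setP => v.
  by rewrite inE [v]row_sum_delta Msum // => j; move: (eM j); rewrite negbK.
(* Modulo the maximal [M], the class of [e i] spans the quotient and has annihilator [m]. With [e j]
   congruent to [a j *: e i], every [v] is congruent to [(\sum_j a j * v 0 j) *: e i], so this
   coefficient lies in [m] when [v] is in [M], and multiplying it by [y] gives 0. *)
pose m := [set r | r *: e i \in M].
have [a ea] : exists a : 'I_t -> R, forall j, e j - a j *: e i \in M.
  have ex j : exists b, e j - b *: e i \in M by exact: maxM.
  by exists (fun j => xchoose (ex j)) => j; apply: xchooseP (ex j).
have [||||y y0 my] := @prime_ideal_annihilator R m.
- by move=> b r s; rewrite !inE scalerDl -scalerA; apply: ML.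
- by rewrite inE scale0r.
- by rewrite inE scale1r.
(* If [r *: e i] is outside [M], then [e i] is congruent to a multiple [b *: (r *: e i)]; scaling by
   [s] brings in [r * s]. *)
- move=> r s; rewrite !inE => rsM; case: (boolP (r *: e i \in M)) => //= rM.
  have [b /(MZ s)] := maxM _ (e i) rM.
  rewrite scalerBr !scalerA mulrCA [s * r]mulrC -scalerA => sM.
  by rewrite -[s *: e i](subrK (b *: ((r * s) *: e i))); apply: MD => //; apply: MZ.
exists (\row_j (a j * y)).
  rewrite inE; apply/forall_inP => v vM; apply/eqP.
  under eq_bigr do rewrite mxE mulrAC.
  rewrite -mulr_suml my // inE scaler_suml.
  have -> : \sum_j (a j * v 0 j) *: e i = v - \sum_j v 0 j *: (e j - a j *: e i).
    rewrite {2}[v]row_sum_delta -sumrB; apply: eq_bigr => j _.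
    by rewrite scalerBr opprB addrC subrK scalerA mulrC.
  by apply: MB => //; apply: Msum.
(* Coordinate [i] of the witness is [y] itself, because [a i] is 1 modulo [m]. *)
apply: contraNneq y0 => /rowP/(_ i); rewrite !mxE => aiy0.
have : 1 - a i \in m by rewrite inE scalerBl scale1r.
by move/my; rewrite mulrBl mul1r aiy0 subr0 => ->.
Qed.

Lemma count_rows_code_array (F : finType) (n t : nat) (D : {set 'rV[F]_n})
    (f : 'I_t -> 'I_n) (u : 'rV[F]_t) :
  #|[set i | row i (colsub f (code_array D)) == u]| =
  #|[set c in D | colsub f c == u]|.
Proof.
have rowE i : row i (colsub f (code_array D)) = colsub f (enum_val i).
  by apply/rowP => j; rewrite !mxE.
rewrite -(card_imset _ enum_val_inj); apply: eq_card => c.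
rewrite inE; apply/imsetP/andP => [[i] | [cD fc]].
  by rewrite inE rowE => fi ->; rewrite enum_valP.
by exists (enum_rank_in cD c); rewrite ?inE ?rowE enum_rankK_in.
Qed.

Lemma has_strength_linearP (R : finComPzRingType) (n t : nat)
    (C : {set 'rV[R]_n}) (linC : linear_code C) (let_n : (t <= n)%N) :
  reflect (forall f : 'I_t -> 'I_n, injective f ->
             [set colsub f c | c in C] = setT)
          (has_strength C t).
Proof.
have [C0 CL] := linC.
apply: (iffP (has_strengthP C t)) => [[l /orthogonal_arrayP[_ oaC]] f injf | surj].
  apply/setP => u; rewrite inE.
  have : (0 < #|[set c in C | colsub f c == u]|)%N.
    (* All fibres have the same size, and the fibre over 0 contains the zero codeword. *)
    rewrite -count_rows_code_array oaC // -(oaC f injf 0) count_rows_code_array.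
    apply/card_gt0P; exists 0; rewrite inE C0; apply/eqP/rowP => j.
    by rewrite !mxE.
  by case/card_gt0P => c; rewrite inE => /andP[cC /eqP <-]; rewrite imset_f.
exists (#|C| %/ #|{: 'rV[R]_t}|)%N; apply/orthogonal_arrayP; split=> // f injf u.
rewrite count_rows_code_array; pose fib v := [set c in C | colsub f c == v].
(* Translation by a codeword [c0] lying over [v] maps the fibre over 0 onto the fibre over [v]. *)
have fibE v : #|fib v| = #|fib 0|.
  have : v \in [set colsub f c | c in C] by rewrite surj ?inE.
  case/imsetP => c0 c0C ->; rewrite -(card_imset (fib 0) (addrI c0)).
  apply: eq_card => c; rewrite inE; apply/andP/imsetP => [[cC /eqP fc]|[d]].
    exists (c - c0); last by rewrite addrC subrK.
    rewrite inE -[c - c0]addrC -scaleN1r CL //=; apply/eqP/rowP => j.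
    by move/rowP/(_ j): fc; rewrite !mxE => ->; rewrite mulN1r addNr.
  rewrite inE => /andP[dC /eqP fd] ->; rewrite -[c0]scale1r CL //; split=> //.
  by apply/eqP/rowP => j; move/rowP/(_ j): fd; rewrite !mxE => ->; rewrite mul1r addr0.
have -> : #|C| = (#|{: 'rV[R]_t}| * #|fib 0%R|)%N.
  rewrite -sum1_card (partition_big (fun c => colsub f c) predT) //=.
  rewrite -sum_nat_const; apply: eq_bigr => v _.
  by rewrite sum1_card -(fibE v); apply: eq_card => c; rewrite !inE.
by rewrite mulKn ?fibE //; apply/card_gt0P; exists (0 : 'rV[R]_t).
Qed.

Lemma min_wH_le (R : finComPzRingType) (n : nat) (D : {set 'rV[R]_n}) x :
  x \in D -> x != 0 -> (min_wH D <= wH x)%N.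
Proof.
move=> xD x0; rewrite /min_wH -minEnat -leEnat.
by apply: Order.TotalTheory.bigmin_le_cond; rewrite xD.
Qed.

Lemma min_wH_attained (R : finComPzRingType) (n : nat) (D : {set 'rV[R]_n}) z :
  z \in D -> z != 0 -> exists x, [/\ x \in D, x != 0 & min_wH D = wH x].
Proof.
move=> zD z0; pose P x := (x \in D) && (x != 0).
have Pz : P z by rewrite /P zD.
case: (@arg_minnP _ z P (@wH R n) Pz) => x /andP[xD x0] minx.
exists x; split=> //; apply/eqP; rewrite eqn_leq min_wH_le //=.
rewrite /min_wH -minEnat -leEnat.
(* The default value [n] must also be bounded below by [wH x]. *)
apply: Order.POrderTheory.le_bigmin; last exact: minx.
by rewrite leEnat -[leqRHS]card_ord max_card.
Qed.

Lemma lt_min_wH_has_strength (R : finComPzRingType) (n t : nat)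
    (C : {set 'rV[R]_n}) :
  linear_code C -> (t <= n)%N -> (t < min_wH (dual_code C))%N ->
  has_strength C t.
Proof.
move=> linC let_n lt_t; have [C0 CL] := linC.
apply/has_strength_linearP => // f injf; apply/eqP; apply: contraTT lt_t => properM.
have linM : linear_code [set colsub f c | c in C].
  split; first by apply/imsetP; exists 0 => //; apply/rowP => j; rewrite !mxE.
  move=> a _ _ /imsetP[c cC ->] /imsetP[d dC ->]; apply/imsetP.
  by exists (a *: c + d); [exact: CL | apply/rowP => j; rewrite !mxE].
have [y yM y0] := dual_code_neq0 _ _ _ linM properM.
(* This is [y] extended by zero off the chosen columns: as [f] is injective, each sum has at most
   one term. Hence [x] has weight at most [t]. *)
pose x : 'rV[R]_n := \row_j \sum_(i | f i == j) y 0 i.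
have xf i : x 0 (f i) = y 0 i.
  by rewrite mxE (big_pred1 i) // => k; rewrite (inj_eq injf).
rewrite -leqNgt; apply: leq_trans (min_wH_le _ _ _ x _ _) _.
- rewrite inE; apply/forall_inP => c cC.
  move: yM; rewrite inE => /forall_inP/(_ _ (imset_f _ cC))/eqP yc.
  apply/eqP; rewrite -[RHS]yc (partition_big f predT) //=; apply: eq_bigr => j _.
  by rewrite mxE mulr_suml; apply: eq_bigr => i /eqP <-; rewrite mxE.
- apply: contraNneq y0 => xE; apply/eqP/rowP => i.
  by rewrite -xf xE !mxE.
- rewrite -[leqRHS]card_ord -(card_codom injf); apply/subset_leq_card/subsetP => j.
  rewrite inE; apply: contraR => jf; rewrite mxE big_pred0 // => i.
  by apply: contraNF jf => /eqP <-; apply: codom_f.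
Qed.

Lemma has_strength_lt_wH (R : finComPzRingType) (n t : nat)
    (C : {set 'rV[R]_n}) (x : 'rV[R]_n) :
  linear_code C -> (t <= n)%N -> has_strength C t ->
  x \in dual_code C -> x != 0 -> (t < wH x)%N.
Proof.
move=> linC let_n strC xC x0; rewrite ltnNge; apply: contra x0 => le_xt.
pose S := [set i | x 0 i != 0].
(* The support of [x] is padded to exactly [t] columns, which is possible because [t <= n]. *)
have [T sST cardT] : exists2 T : {set 'I_n}, S \subset T & #|T| = t.
  have : (t - #|S| <= #|~: S|)%N by rewrite [#|~: S|]cardsCs setCK card_ord leq_sub2r.
  case/card_geqP => s [uniq_s size_s sSC].
  exists (S :|: [set i in s]); first exact: subsetUl.
  rewrite cardsU [#|[set i in s]|]cardsE (card_uniqP uniq_s) size_s subnKC //.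
  rewrite (_ : _ :&: _ = set0) ?cards0 ?subn0 //; apply/setP => i.
  rewrite in_setI [i \in [set i in s]]inE [RHS]inE; apply/negP => /andP[iS].
  by move/sSC; rewrite in_setC iS.
pose f (k : 'I_t) : 'I_n := enum_val (cast_ord (esym cardT) k).
have injf : injective f by move=> j k /enum_val_inj/cast_ord_inj.
apply/eqP/rowP => i; rewrite [RHS]mxE; apply/eqP/negPn/negP => xi0.
have iS : i \in S by rewrite inE.
have iT := subsetP sST i iS.
have /has_strength_linearP surj := strC.
pose k0 := cast_ord cardT (enum_rank_in iT i).
have fk0 : f k0 = i by rewrite /f /k0 cast_ordK enum_rankK_in.
(* A codeword that is the unit vector at [i] on [T] pairs with [x] to give [x 0 i], since [x]
   vanishes off [T]; duality forces this to be 0. *)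
have : delta_mx 0 k0 \in [set colsub f c | c in C] by rewrite surj ?inE.
case/imsetP => c cC /rowP cE.
have := xC; rewrite inE => /forall_inP/(_ c cC)/eqP.
rewrite (bigD1 i) //= big1 => [|j ji].
  have := cE k0; rewrite !mxE fk0 !eqxx => <-.
  by rewrite mulr1 addr0; apply/eqP.
have [jS|] := boolP (j \in S); last by rewrite inE negbK => /eqP->; rewrite mul0r.
have jT := subsetP sST j jS.
pose k := cast_ord cardT (enum_rank_in jT j).
have fk : f k = j by rewrite /f /k cast_ordK enum_rankK_in.
have := cE k; rewrite !mxE fk /= (_ : k == k0 = false) => [<-|].
  by rewrite mulr0.
by apply: contraNF ji => /eqP kk0; rewrite -fk kk0 fk0.
Qed.

Theorem theorem3p1 (R : finComPzRingType) (n : nat) (n_ge1 : (1 <= n)%N)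
    (C : {set 'rV[R]_n}) (linC : linear_code C)
    (dualC_neq0 : dual_code C != [set 0]) :
  Str C = (min_wH (dual_code C) - 1)%N.
Proof.
have [z zC z0] : exists2 z, z \in dual_code C & z != 0.
  have dual0 : 0 \in dual_code C.
    rewrite inE; apply/forall_inP => c _; rewrite big1 // => i _.
    by rewrite mxE mul0r.
  apply/exists_inP; apply: contraR dualC_neq0 => /exists_inPn dual_sub.
  rewrite eqEsubset sub1set dual0 andbT; apply/subsetP => v /dual_sub.
  by rewrite negbK inE.
have [x [xC x0 minE]] := min_wH_attained _ _ _ z zC z0.
have lt_wH t : (t <= n)%N -> has_strength C t -> (t < min_wH (dual_code C))%N.
  by rewrite minE => let_n strC; apply: has_strength_lt_wH linC let_n strC xC x0.
(* Strength 0 always holds, so the minimum weight is positive and the truncated subtraction of 1 is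
   exact. *)
have min_gt0 := lt_wH 0 (leq0n n) (has_strength0 C).
have min_le_n : (min_wH (dual_code C) <= n)%N.
  by rewrite minE -[leqRHS]card_ord max_card.
have lt_pred : ((min_wH (dual_code C)).-1 < n.+1)%N.
  by rewrite ltnS (leq_trans (leq_pred _)).
apply/eqP; rewrite subn1 eqn_leq; apply/andP; split.
  apply/bigmax_leqP => t strC; rewrite -ltnS prednK //; apply: lt_wH strC.
  by rewrite -ltnS.
apply: (@leq_bigmax_cond _ _ (fun t : 'I_n.+1 => val t) (Ordinal lt_pred)).
by apply: lt_min_wH_has_strength => //=; rewrite prednK.
Qed.
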